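(* If $\mathcal{C}$ is a complete admissible uniform clutter, then the Alexander dual $\Upsilon(\mathcal{C})$ of $\mathcal{C}$ is also a complete admissible uniform clutter.
   Context: A clutter $\mathcal{C}$ with finite vertex set $X$ is a family $E(\mathcal{C})$ of subsets of $X$, called edges, none of which is included in another. A vertex cover of $\mathcal{C}$ is a subset of $X$ meeting every edge; it is minimal if no proper subset is a vertex cover. The Alexander dual $\Upsilon(\mathcal{C})$ is the clutter on $X$ whose edges are the minimal vertex covers of $\mathcal{C}$. The edge ideal $I(\mathcal{C})$ is the ideal of the polynomial ring $K[X]$ over a field $K$ generated by the monomials $\prod_{x\in e}x$, $e\in E(\mathcal{C})$; its height equals the minimum size of a vertex cover. A perfect matching of $\mathcal{C}$ is a set of pairwise disjoint edges whose union is $X$. Given two partitions $X^1,\ldots,X^d$ and $e_1,\ldots,e_g$ of $X$ with $|e_i\cap X^j|\leq 1$ for all $i,j$, a subset $e\subset X$ of size $k\geq 1$ is called admissible if $e=\{x_1,\ldots,x_k\}$ with $x_i\in X^i\cap e_{j_i}$ for $i=1,\ldots,k$ and $j_1\leq\cdots\leq j_k$. A clutter $\mathcal{C}$ is a complete admissible uniform clutter if it has a perfect matching $e_1,\ldots,e_g$, where $g$ is the height of $I(\mathcal{C})$, and there is a partition $X^1,\ldots,X^d$ of $X$ such that every edge of $\mathcal{C}$ intersects each $X^i$ in exactly one vertex, every inclusion-maximal admissible subset of $X$ is an edge of $\mathcal{C}$, and these are the only edges of $\mathcal{C}$. (Thus, writing $x^i_j$ for the unique element of $X^i\cap e_j$,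 the edges of $\mathcal{C}$ are exactly the sets $\{x^1_{j_1},x^2_{j_2},\ldots,x^d_{j_d}\}$ with $1\leq j_1\leq j_2\leq\cdots\leq j_d\leq g$.) *)

(* Defs.v *)
From mathcomp Require Import all_boot all_algebra.
From mathcomp Require Import ring_quotient mpoly.

Set Implicit Arguments.
Unset Strict Implicit.
Unset Printing Implicit Defensive.

Import GRing.Theory.
Local Open Scope ring_scope.

(** ** Height of an ideal *)

Section Height.
Variable R : comNzRingType.

(* [idealr_closed] includes properness ([1 \notin P]). *)
Definition prime_ideal (P : {pred R}) : Prop :=
  idealr_closed P /\ prime_idealr_closed P.

(* A strict chain of primes P 0 < P 1 < ... < P h = Q; the values of P beyond
   h are irrelevant. *)
Definition prime_chain (h : nat) (P : nat -> {pred R}) (Q : {pred R}) : Prop :=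
  [/\ forall i, (i <= h)%N -> prime_ideal (P i),
      forall i, (i < h)%N ->
        {subset P i <= P i.+1} /\ ~ {subset P i.+1 <= P i}
    & P h =i Q].

Definition prime_height (Q : {pred R}) (h : nat) : Prop :=
  (exists P, prime_chain h P Q) /\
  (forall h' P, prime_chain h' P Q -> (h' <= h)%N).

(* The least height of a prime ideal containing I. Primes of infinite height
   satisfy [prime_height] for no h, so they do not affect the minimum. *)
Definition ideal_height (I : R -> Prop) (h : nat) : Prop :=
  (exists Q : {pred R},
     [/\ prime_ideal Q, forall f, I f -> f \in Q & prime_height Q h]) /\
  (forall (Q : {pred R}) (h' : nat),
     prime_ideal Q -> (forall f, I f -> f \in Q) -> prime_height Q h' ->
     (h <= h')%N).

End Height.

(** ** Clutters on a finite vertex set T *)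

Record clutter (T : finType) := Clutter {
  edges : {set {set T}};
  edges_antichain : {in edges &, forall e f : {set T}, e \subset f -> e = f}
}.

Section Clutters.
Variable T : finType.
Implicit Types (C : clutter T) (A B e : {set T}).

Definition vertex_cover C : pred {set T} :=
  fun A => [forall e in edges C, A :&: e != set0].

Definition minimal_vertex_covers C : {set {set T}} :=
  [set A | minset (vertex_cover C) A].

Lemma minimal_vertex_covers_antichain C :
  {in minimal_vertex_covers C &, forall A B : {set T}, A \subset B -> A = B}.
Proof.
move=> A B; rewrite !inE => /minsetP[covA _] /minsetP[_ minB] sAB.
exact: minB.
Qed.

Definition alexander_dual C : clutter T :=
  Clutter (@minimal_vertex_covers_antichain C).

(* K[T] is {mpoly K[#|T|]}, the vertex x being the variable of index
   [enum_rank x]. *)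
Definition edge_monomial (K : fieldType) e : {mpoly K[#|T|]} :=
  \prod_(x in e) 'X_(enum_rank x).

Definition edge_ideal (K : fieldType) C (f : {mpoly K[#|T|]}) : Prop :=
  exists c : {set T} -> {mpoly K[#|T|]},
    f = \sum_(e in edges C) c e * edge_monomial K e.

Definition perfect_matching C (M : {set {set T}}) : Prop :=
  [/\ M \subset edges C, trivIset M & cover M = [set: T]].

(* X^1, ..., X^d (here numbered from 0) are the parts of a partition of T; by
   [partition] they are nonempty. *)
Definition indexed_partition (d : nat) (X : 'I_d -> {set T}) : Prop :=
  injective X /\ partition [set X i | i : 'I_d] [set: T].

Definition admissible (d g : nat) (X : 'I_d -> {set T}) (M : 'I_g -> {set T})
    (A : {set T}) : Prop :=
  exists (k : nat) (le_kd : (k <= d)%N) (x : 'I_k -> T) (j : 'I_k -> 'I_g),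
    [/\ (0 < k)%N /\ #|A| = k,
        A = [set x i | i : 'I_k],
        forall i, x i \in X (widen_ord le_kd i) :&: M (j i)
      & forall a b : 'I_k, (a <= b)%N -> (j a <= j b)%N].

Definition maximal_admissible (d g : nat) (X : 'I_d -> {set T})
    (M : 'I_g -> {set T}) (A : {set T}) : Prop :=
  admissible X M A /\ forall B, admissible X M B -> A \subset B -> B = A.

(* [0 < d] only excludes the empty vertex set: with T empty and d = g = 0 the
   clutter without edges would qualify, but not its dual, whose only edge is
   the empty set. *)
Definition complete_admissible_uniform (K : fieldType) C : Prop :=
  exists (g : nat) (M : 'I_g -> {set T}) (d : nat) (X : 'I_d -> {set T}),
    [/\ injective M /\ perfect_matching C [set M j | j : 'I_g],
        ideal_height (@edge_ideal K C) g,
        (0 < d)%N /\ indexed_partition X,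
        forall e i, e \in edges C -> #|e :&: X i| = 1%N
      & forall A, A \in edges C <-> maximal_admissible X M A].

End Clutters.

(* Main.v *)
Require Import Defs.
From mathcomp Require Import all_boot all_algebra.
From mathcomp Require Import ring_quotient mpoly.
From Stdlib Require Import Classical.

Set Implicit Arguments.
Unset Strict Implicit.
Unset Printing Implicit Defensive.

Import GRing.Theory.
Local Open Scope ring_scope.

(** The two partitions of a complete admissible uniform clutter arrange its
    vertices as a d x g grid, with rows X^i and columns e_j, in which every
    row meets every column in one cell.  The maximal admissible sets, hence the
    edges, are then exactly the graphs {(i, f i)} of the monotone maps f from
    rows to columns ([maximal_admissibleP]).

    Such a description is self-dual: the minimal vertex covers are the graphs
    {(h j, j)} of the monotone maps h from columns to rows
    ([dual_grid_edges]).  The graphs of f and h always meet, since the monotone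
    self-map h \o f of a finite chain has a fixed point ([graphs_meet]).
    Conversely a vertex cover A contains the graph of some h
    ([monotone_transversal]): follow the leftmost monotone path that avoids A,
    row after row; it has to get stuck, and the cells that it is pushed across
    lie in A and are one in each column, at rows increasing with the column.
    So transposing the grid exchanges C and its dual, and the columns of one
    clutter are the rows of the other.

    What remains is that g is the height of the edge ideal, which is the least
    size of a vertex cover ([edge_ideal_height]); g is that size, because the g
    columns are disjoint edges and a row is a cover with g elements.  A prime
    ideal contains the edge ideal if and only if the variables in it form a
    vertex cover ([edge_ideal_sub]).  If it contains k variables, then adding
    these one at a time gives a chain of k strict inclusions of primes, so its
    height is at least k.  It is exactly k when the prime is generated by
    the k variables.  A chain ending there can be continued by adding the other
    n - k variables, and no chain of primes of K[x_1..x_n] has more than n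
    strict inclusions.  That last fact is proved by counting.  Given a chain of
    primes P_0, ..., P_m and f_i in P_i but not in P_(i-1), the monomials in
    f_1, ..., f_m are linearly independent modulo P_0; those with exponents
    below N are N^m polynomials of degree O(N), so N^m = O(N^n) and m <= n
    ([growthS], [growth_bound]). *)

(** * Ideals and primes *)

Section Ideals.
Variables (R : comNzRingType) (P : {pred R}).
Hypothesis idealP : idealr_closed P.

Lemma ideal_add u v : u \in P -> v \in P -> u + v \in P.
Proof. by case: idealP => _ _ h Pu Pv; rewrite -[u]mul1r h. Qed.

Lemma ideal_mull a u : u \in P -> a * u \in P.
Proof. by case: idealP => P0 _ h Pu; rewrite -[_ * _]addr0 h. Qed.

Lemma ideal_sub u v : u \in P -> v \in P -> u - v \in P.
Proof.
by move=> Pu Pv; rewrite ideal_add // -mulN1r ideal_mull.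
Qed.

Lemma ideal_sum (I : eqType) (s : seq I) (F : I -> R) :
  (forall i, i \in s -> F i \in P) -> \sum_(i <- s) F i \in P.
Proof.
case: idealP => P0 _ _ PF; rewrite big_seq.
elim/big_ind: _ => //; exact: ideal_add.
Qed.

Lemma prime_prod (I : eqType) (s : seq I) (F : I -> R) :
  prime_idealr_closed P -> \prod_(i <- s) F i \in P ->
  exists2 i, i \in s & F i \in P.
Proof.
case: idealP => _ P1 _ primeP; elim: s => [|i s IH].
  by rewrite big_nil (negPf P1).
rewrite big_cons => /primeP /orP[Pi|/IH[j sj Pj]].
  by exists i; rewrite ?mem_head.
by exists j; rewrite // inE sj orbT.
Qed.

End Ideals.

(** * The dimension of a polynomial ring bounds its chains of primes *)

Section Dimension.
Variables (K : fieldType) (n : nat).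
Local Notation R := {mpoly K[n]}.
Implicit Types (P Q : {pred R}) (f : R) (us vs : seq R).

Definition free_mod P us : Prop :=
  forall c : nat -> K, \sum_(i < size us) c i *: us`_i \in P ->
  forall i, (i < size us)%N -> c i = 0.

Lemma free_mod1 P : idealr_closed P -> free_mod P [:: 1].
Proof.
move=> idP; have [_ P1 _] := idP => c; rewrite big_ord1 /= => Pc [|//] _.
apply/eqP; apply: contraNT P1 => c0.
by rewrite -[1](scale1r) -(mulVf c0) -scalerA -mul_mpolyC ideal_mull.
Qed.

(** Modulo P', which contains f, a relation between [us] and the multiples of
    [f] becomes a relation between the [us] alone, hence is trivial there; what
    is left is f times a relation between the [vs], and f can be cancelled
    because P is prime. *)
Lemma free_mod_cat P P' f us vs :
  prime_ideal P -> prime_ideal P' -> {subset P <= P'} -> f \in P' -> f \notin P ->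
  free_mod P' us -> free_mod P vs ->
  free_mod P (us ++ [seq f * v | v <- vs]).
Proof.
move=> [idP primeP] [idP' _] sPP' P'f Pf free_us free_vs c.
rewrite size_cat size_map big_split_ord /=.
under eq_bigr => i _ do rewrite nth_cat ltn_ord.
under [X in _ + X]eq_bigr => i _.
  rewrite nth_cat ltnNge leq_addr /= addKn (nth_map 0) // scalerAr.
  over.
rewrite -mulr_sumr => Pc.
have cus i : (i < size us)%N -> c i = 0.
  apply: free_us; rewrite -[X in X \in _](addrK (f * \sum_(i < size vs)
    c (size us + i)%N *: vs`_i)).
  apply: (ideal_sub idP'); first exact: sPP'.
  by rewrite mulrC ideal_mull.
move: Pc; rewrite big1 ?add0r => [|i _]; last by rewrite cus ?scale0r.
move=> /primeP; rewrite (negPf Pf) /= => /(free_vs (fun i => c (size us + i)%N)) cvs i.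
have [/cus->//|le_ui lt_i] := ltnP i (size us).
by rewrite -(subnKC le_ui) cvs // ltn_subLR.
Qed.

Lemma card_bounded_monomials w : (#|{: 'X_{1..n < w}}| <= w ^ n)%N.
Proof.
case: w => [|w].
  by rewrite eq_card0 // => m; have := bmdeg m.
rewrite -[leqRHS](_ : #|{ffun 'I_n -> 'I_w.+1}| = _); last first.
  by rewrite card_ffun !card_ord.
(* Each exponent is bounded by the total degree, so a box holds them all. *)
pose F (m : 'X_{1..n < w.+1}) := [ffun i : 'I_n => inord (m i) : 'I_w.+1].
apply: (@leq_card _ _ F) => m1 m2 /ffunP eqF.
apply/val_inj/mnmP => i; have := congr1 val (eqF i); rewrite !ffunE /=.
have lt_m (m : 'X_{1..n < w.+1}) : (m i < w.+1)%N.
  by apply: leq_ltn_trans (bmdeg m); rewrite mdegE (bigD1 i) //= leq_addr.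
by rewrite !inordK.
Qed.

(** The coefficient matrix of the family is row-free, and it has at most w^n
    columns. *)
Lemma free_mod_size P us w : 0 \in P -> free_mod P us ->
  all (fun u => msize u <= w)%N us -> (size us <= w ^ n)%N.
Proof.
move=> P0 free_us /allP us_w; apply: leq_trans (card_bounded_monomials w).
pose A := \matrix_(i < size us, j < #|{: 'X_{1..n < w}}|)
  (us`_i)@_(enum_val j : 'X_{1..n < w}).
suff /eqP <- : row_free A by exact: rank_leq_col.
rewrite -kermx_eq0; apply/rowV0P => v /sub_kermxP vA0.
pose c i := if insub i is Some k then v 0 k else 0.
have cE (i : 'I_(size us)) : c i = v 0 i by rewrite /c valK.
apply/rowP => i; rewrite mxE -cE; apply: free_us => //.
rewrite [X in X \in P](_ : _ = 0) //; apply/mpolyP => m.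
rewrite mcoeff0 raddf_sum /=; case: (ltnP (mdeg m) w) => [ltmw|lewm].
  have := congr1 (fun B : 'rV_ _ => B 0 (enum_rank (BMultinom ltmw))) vA0.
  rewrite !mxE => h; rewrite -[RHS]h; apply: eq_bigr => j _.
  by rewrite mxE enum_rankK mcoeffZ cE.
rewrite big1 // => j _; rewrite mcoeffZ memN_msupp_eq0 ?mulr0 //.
by apply: msize_mdeg_ge; apply: leq_trans lewm; apply/us_w/mem_nth.
Qed.

(** Lower bound m on the Gelfand-Kirillov dimension of the quotient by P: the
    polynomials of degree O(N) contain N^m that are independent modulo P. *)
Definition growth P m : Prop :=
  exists D, forall N, exists us,
    [/\ size us = (N ^ m)%N, all (fun u => msize u <= (N * D).+1)%N us
      & free_mod P us].

Lemma growth0 P : idealr_closed P -> growth P 0.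
Proof.
move=> idP; exists 0 => N; exists [:: 1]; split => //.
  by rewrite /= msize1 muln0.
exact: free_mod1.
Qed.

(** Take f in P' but not in P, and a family vs of N^m polynomials independent
    modulo P'.  The N^(m+1) products f^k v with k < N are independent modulo P;
    they are assembled one power of f at a time by [free_mod_cat], as
    us |-> vs ++ f us. *)
Lemma growthS P P' m : prime_ideal P -> prime_ideal P' -> {subset P <= P'} ->
  ~ {subset P' <= P} -> growth P' m -> growth P m.+1.
Proof.
move=> prP prP' sPP' nsP'P [D growD].
(* The inclusion of P' in P is not decidable, hence the classical step. *)
have [f /negP] : exists f, ~ ((f \in P') ==> (f \in P)).
  by apply: not_all_ex_not => h; apply: nsP'P => f; exact/implyP/h.
rewrite negb_imply => /andP[P'f Pf].
exists (D + (msize f).+1)%N => N; have [vs [sz_vs vsD free_vs]] := growD N.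
suff: forall k, (k <= N)%N -> exists us, [/\ size us = (k * N ^ m)%N,
    all (fun u => msize u <= (N * D + k * (msize f).+1).+1)%N us & free_mod P us].
  by move=> /(_ N (leqnn N))[us [sz us_w free_us]]; exists us; rewrite mulnDr expnS.
elim=> [_|k IH lt_kN]; first by exists [::]; split=> // c _ i; rewrite ltn0.
have [us [sz_us usD free_us]] := IH (ltnW lt_kN).
exists (vs ++ [seq f * u | u <- us]); split.
- by rewrite size_cat size_map sz_vs sz_us mulSn.
- rewrite all_cat; apply/andP; split.
    apply: sub_all vsD => u /leq_trans; apply; by rewrite ltnS leq_addr.
  rewrite all_map; apply: sub_all usD => u /= uD.
  apply: leq_trans (msizeM_le _ _) _.
  by rewrite mulSn addnCA addSn ltnS -addnS leq_add2l.
- exact: (free_mod_cat prP prP').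
Qed.

(** If m > n, then N^(n+1) <= N^m <= (N D + 1)^n <= N^n (D + 1)^n, which fails
    once N exceeds (D + 1)^n. *)
Lemma growth_bound P m : idealr_closed P -> growth P m -> (m <= n)%N.
Proof.
move=> [P0 _ _] [D growD]; rewrite leqNgt; apply/negP => lt_nm.
have [us [sz_us us_w free_us]] := growD (D.+1 ^ n).+1.
set N := (_).+1 in sz_us us_w.
have := free_mod_size P0 free_us us_w; rewrite sz_us => le1.
have : (N ^ n.+1 <= (N * D.+1) ^ n)%N.
  apply: leq_trans (leq_trans le1 _); first by rewrite leq_pexp2l.
  have [->|n_gt0] := posnP n; first by rewrite !expn0.
  by rewrite leq_exp2r // mulnS -add1n leq_add2r.
by rewrite expnMn expnSr leq_pmul2l ?expn_gt0 // ltnn.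
Qed.

Lemma growth_eqi P P' m : P =i P' -> growth P m -> growth P' m.
Proof.
move=> eqP [D growD]; exists D => N; have [us [sz_us us_w free_us]] := growD N.
by exists us; split=> // c; rewrite -eqP; apply: free_us.
Qed.

Lemma growth_chain h (P : nat -> {pred R}) Q m :
  prime_chain h P Q -> growth Q m -> growth (P 0) (h + m).
Proof.
move=> [primeP ltP eqQ] growQ.
suff: forall k, (k <= h)%N -> growth (P (h - k)%N) (k + m).
  by move/(_ h (leqnn h)); rewrite subnn.
elim=> [_|k IH lt_kh].
  by rewrite subn0; apply: growth_eqi growQ => f; rewrite eqQ.
have hk : (h - k = (h - k.+1).+1)%N by rewrite -subSn.
have lt_hk : (h - k.+1 < h)%N by rewrite -hk leq_subr.
have [sPP' nsP'P] := ltP _ lt_hk.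
apply: (growthS _ _ sPP' nsP'P); last by rewrite -hk; apply/IH/ltnW.
  exact/primeP/ltnW.
exact: primeP.
Qed.

(** * Primes generated by variables *)

Implicit Types S : {set 'I_n}.

(** The ideal generated by the variables of index in S, encoded as the kernel
    of the substitution that kills these variables: it is thus decidable, and
    prime because the target is an integral domain. *)
Definition coordinate_prime (S : {set 'I_n}) : {pred R} :=
  [pred f | f \mPo [tuple if i \in S then 0 else 'X_i | i < n] == 0].

Lemma coordinate_prime_ideal S : prime_ideal (coordinate_prime S).
Proof.
split; first split.
- by rewrite inE raddf0.
- by rewrite inE rmorph1 oner_eq0.
- move=> a u v; rewrite !inE => /eqP u0 /eqP v0.
  by rewrite rmorphD rmorphM /= u0 v0 mulr0 addr0.
- by move=> u v; rewrite !inE rmorphM mulf_eq0.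
Qed.

Lemma mem_coordinate_prime S i : ('X_i \in coordinate_prime S) = (i \in S).
Proof.
rewrite inE comp_mpolyXU -tnth_nth tnth_mktuple.
case: ifP => // _; first by rewrite eqxx.
apply/negP => /eqP/(congr1 (mcoeff U_(i))); rewrite mcoeffXU mcoeff0 eqxx.
by move/eqP; rewrite oner_eq0.
Qed.

(** Modulo an ideal that contains the variables in S, every polynomial is
    congruent to the one obtained by killing them. *)
Lemma coordinate_prime_min S Q : idealr_closed Q ->
  (forall i, i \in S -> 'X_i \in Q) -> {subset coordinate_prime S <= Q}.
Proof.
move=> idQ QX f; rewrite inE => /eqP kill_f.
have [Q0 _ _] := idQ.
suff: f - (f \mPo [tuple if i \in S then 0 else 'X_i | i < n]) \in Q.
  by rewrite kill_f subr0.
elim/mpolyind: f {kill_f} => [|c m p _ _ IH]; first by rewrite raddf0 subr0.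
rewrite raddfD opprD addrACA; apply: ideal_add => //=.
rewrite comp_mpolyZ -scalerBr -mul_mpolyC; apply: ideal_mull => //.
rewrite comp_mpolyX mpolyXE_id.
have QB i : 'X_i - tnth [tuple if i \in S then 0 else 'X_i | i < n] i \in Q.
  by rewrite tnth_mktuple; case: ifP => [/QX|]; rewrite ?subr0 ?subrr.
elim/big_ind2: _ => [|u u' v v' Qu Qv|i _]; first by rewrite subrr.
  rewrite [X in X \in _](_ : _ = v * (u' - u) + u' * (v' - v)).
    by apply: (ideal_add idQ); apply: (ideal_mull idQ).
  by rewrite !mulrBr [RHS]addrC (mulrC u' v) addrA subrK (mulrC v u).
by rewrite subrXX mulrC (ideal_mull idQ).
Qed.

Lemma coordinate_prime_sub (S S' : {set 'I_n}) :
  S \subset S' -> {subset coordinate_prime S <= coordinate_prime S'}.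
Proof.
move=> /subsetP sSS'; apply: coordinate_prime_min => [|i /sSS'].
  by have [] := coordinate_prime_ideal S'.
by rewrite mem_coordinate_prime.
Qed.

(** Adding the remaining n - #|S| variables one at a time is a chain of primes,
    which [growthS] climbs down. *)
Lemma growth_coordinate_prime S : growth (coordinate_prime S) (n - #|S|).
Proof.
move Dk: (n - #|S|)%N => k; elim: k => [|k IH] in S Dk *.
  by apply: growth0; have [] := coordinate_prime_ideal S.
have /subsetPn[i _ notSi] : ~~ ([set: 'I_n] \subset S).
  by apply/negP => /subset_leq_card; rewrite cardsT card_ord -subn_eq0 Dk.
apply: (@growthS _ (coordinate_prime (i |: S))).
- exact: coordinate_prime_ideal.
- exact: coordinate_prime_ideal.
- by apply: coordinate_prime_sub; apply: subsetUr.
- move/(_ 'X_i); rewrite !mem_coordinate_prime setU11 => /(_ isT).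
  exact/negP.
- by apply: IH; rewrite cardsU1 notSi add1n subnS Dk.
Qed.

(** The primes generated by the first i elements of S, for i < #|S|, followed
    by Q in place of the one generated by the whole of S. *)
Lemma coordinate_chain S Q : prime_ideal Q ->
  (forall i, i \in S -> 'X_i \in Q) -> exists P : nat -> {pred R}, prime_chain #|S| P Q.
Proof.
move=> primeQ QX; have [idQ _] := primeQ.
pose F i := [set x in take i (enum S)].
exists (fun i => if (i < #|S|)%N then coordinate_prime (F i) else Q).
have sFS i : F i \subset S.
  by apply/subsetP => x; rewrite inE => /mem_take; rewrite mem_enum.
split=> [i _|i lt_iS|]; last by rewrite ltnn.
  by case: ifP => _ //; apply: coordinate_prime_ideal.
rewrite lt_iS.
have [x0 _] : exists x0, x0 \in S.
  by apply/set0Pn; rewrite -card_gt0 (leq_trans _ lt_iS).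
pose x := nth x0 (enum S) i.
have lt_i : (i < size (enum S))%N by rewrite -cardE.
have Sx : x \in S by rewrite -mem_enum mem_nth.
have FSE : F i.+1 = x |: F i.
  by apply/setP=> y; rewrite !inE (take_nth x0) // mem_rcons inE.
have notFx : x \notin F i.
  have : uniq (take i.+1 (enum S)) by apply/take_uniq/enum_uniq.
  by rewrite (take_nth x0) // rcons_uniq inE => /andP[].
split.
  case: ifP => _; first by apply: coordinate_prime_sub; rewrite FSE subsetUr.
  by apply: coordinate_prime_min => // y /(subsetP (sFS _)); apply: QX.
move=> /(_ 'X_x); rewrite mem_coordinate_prime (negPf notFx); case: ifP => _.
  by rewrite mem_coordinate_prime FSE setU11 => /(_ isT).
by rewrite QX // => /(_ isT).
Qed.

(** A chain of length h ending here is prolonged by n - #|S| further steps, so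
    h + (n - #|S|) <= n. *)
Lemma prime_height_coordinate_prime S : prime_height (coordinate_prime S) #|S|.
Proof.
have primeS := coordinate_prime_ideal S; split.
  by apply: coordinate_chain => // i; rewrite mem_coordinate_prime.
move=> h P chainP; have [primeP _ _] := chainP.
have := growth_chain chainP (growth_coordinate_prime S).
have [idP _] := primeP 0 (leq0n h).
move=> /(growth_bound idP); have := max_card (mem S); rewrite card_ord => leSn.
by rewrite -[X in (_ <= X)%N -> _](subnKC leSn) leq_add2r.
Qed.

End Dimension.

(** * The height of an edge ideal is the least size of a vertex cover *)

Section EdgeIdealHeight.
Variables (K : fieldType) (T : finType) (C : clutter T).
Local Notation R := {mpoly K[#|T|]}.

Lemma edge_ideal_monomial e : e \in edges C ->
  edge_ideal C (edge_monomial K e).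
Proof.
move=> Ce; exists (fun e' => (e' == e)%:R); rewrite (bigD1 e) //= eqxx mul1r.
by rewrite big1 ?addr0 // => e' /andP[_ /negPf->]; rewrite mul0r.
Qed.

(** A prime contains the monomial of an edge exactly when it contains one of
    the variables of that edge. *)
Lemma edge_ideal_sub (Q : {pred R}) : prime_ideal Q ->
  (forall f, edge_ideal C f -> f \in Q) <->
  vertex_cover C [set x | 'X_(enum_rank x) \in Q].
Proof.
move=> [idQ primeQ]; split=> [QI|/'forall_implyP coverQ _ [c ->]].
  apply/'forall_implyP => e Ce.
  have := QI _ (edge_ideal_monomial Ce); rewrite /edge_monomial -big_enum.
  move=> /(prime_prod idQ primeQ)[x]; rewrite mem_enum => ex Qx.
  by apply/set0Pn; exists x; rewrite !inE Qx.
rewrite -big_enum; apply: ideal_sum => // e; rewrite mem_enum => Ce.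
have /set0Pn[x] := coverQ e Ce; rewrite !inE => /andP[Qx ex].
rewrite /edge_monomial (bigD1 x) //= mulrCA mulrC.
by rewrite ideal_mull.
Qed.

(** A minimum cover A generates a prime of height #|A| containing the ideal; any
    other prime containing the ideal has a cover among its variables, so a
    chain of primes at least that long below it. *)
Lemma edge_ideal_height h :
  (exists2 A, vertex_cover C A & #|A| = h) ->
  (forall A, vertex_cover C A -> (h <= #|A|)%N) ->
  ideal_height (@edge_ideal T K C) h.
Proof.
move=> [A coverA cardA] leh; split.
  pose S := [set enum_rank x | x in A].
  exists (coordinate_prime S : {pred R}); split.
  - exact: coordinate_prime_ideal.
  - apply/edge_ideal_sub; first exact: coordinate_prime_ideal.
    rewrite (_ : [set x | _] = A) //; apply/setP=> x.
    by rewrite inE mem_coordinate_prime mem_imset //; apply: enum_rank_inj.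
  - have <- : #|S| = h by rewrite card_imset //; apply: enum_rank_inj.
    exact: prime_height_coordinate_prime.
move=> Q h' primeQ /edge_ideal_sub - /(_ primeQ) coverQ [_ maxQ].
pose B := [set x | ('X_(enum_rank x) : R) \in Q].
have [P chainP] : exists P, prime_chain #|enum_rank @: B| P Q.
  by apply: coordinate_chain => // _ /imsetP[x /[!inE] Qx ->].
apply: leq_trans (maxQ _ _ chainP).
by rewrite card_imset; [apply: leh | apply: enum_rank_inj].
Qed.

End EdgeIdealHeight.

(** * Grids and graphs of monotone maps *)

Lemma fibers_partition (T : finType) n (p : T -> 'I_n) :
  (forall i, exists v, p v = i) -> Defs.indexed_partition (fun i => [set v | p v == i]).
Proof.
move=> surj_p; split=> [i i' eq_fib|].
  have [v pv] := surj_p i; have : v \in [set v | p v == i] by rewrite inE pv.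
  by rewrite eq_fib inE pv => /eqP.
apply/and3P; split.
- apply/eqP/setP=> v; rewrite inE; apply/bigcupP.
  by exists [set u | p u == p v]; rewrite ?inE // imset_f.
- apply/trivIsetP=> _ _ /imsetP[i _ ->] /imsetP[i' _ ->] neq_fib.
  rewrite -setI_eq0; apply: contraNT neq_fib => /set0Pn[v].
  by rewrite !inE => /andP[/eqP-> /eqP->].
- apply/imsetP => -[i _ fib0]; have [v pv] := surj_p i.
  by have := in_set0 v; rewrite fib0 inE pv eqxx.
Qed.

Lemma partition_fibers (T : finType) n (X : 'I_n -> {set T}) :
  Defs.indexed_partition X -> exists p, forall i, X i = [set v | p v == i].
Proof.
case=> injX /and3P[/eqP coverX /trivIsetP trivX _].
have partP v : exists i, v \in X i.
  have : v \in cover [set X i | i : 'I_n] by rewrite coverX.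
  by case/bigcupP=> _ /imsetP[i _ ->]; exists i.
have [p Xp] := fin_all_exists partP.
exists p => i; apply/setP=> v; rewrite inE; apply/idP/eqP => [Xiv|<-] //.
apply/eqP; apply: contraT => neq_pi.
have := trivX (X (p v)) (X i); rewrite !imset_f // inj_eq // => /(_ isT isT neq_pi).
by move/disjointFr => /(_ _ (Xp v)); rewrite Xiv.
Qed.

Record grid (T : finType) (d g : nat) := Grid {
  row : T -> 'I_d;
  col : T -> 'I_g;
  cell : 'I_d -> 'I_g -> T;
  row_cell : forall i j, row (cell i j) = i;
  col_cell : forall i j, col (cell i j) = j;
  cellK : forall v, cell (row v) (col v) = v
}.

Definition transpose (T : finType) d g (G : grid T d g) : grid T g d :=
  @Grid T g d (col G) (row G) (fun j i => cell G i j)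
    (fun j i => col_cell G i j) (fun j i => row_cell G i j) (cellK G).

Definition monotone m n (f : 'I_m -> 'I_n) : Prop :=
  forall a b : 'I_m, (a <= b)%N -> (f a <= f b)%N.

Definition graph (T : finType) d g (G : grid T d g) (f : 'I_d -> 'I_g) : {set T} :=
  [set v | col G v == f (row G v)].

Section MonotoneGraphs.
Variables (T : finType) (d g : nat) (G : grid T d g).

Lemma mem_graph f i j : (cell G i j \in graph G f) = (j == f i).
Proof. by rewrite inE row_cell col_cell. Qed.

Lemma graphE f : graph G f = [set cell G i (f i) | i : 'I_d].
Proof.
apply/setP=> v; rewrite inE; apply/eqP/imsetP => [cv|[i _ ->]].
  by exists (row G v); rewrite // -cv cellK.
by rewrite row_cell col_cell.
Qed.

Lemma card_graph f : #|graph G f| = d.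
Proof.
rewrite graphE card_imset ?card_ord // => i i' /(congr1 (row G)).
by rewrite !row_cell.
Qed.

Lemma card_graph_row f i : #|graph G f :&: [set v | row G v == i]| = 1%N.
Proof.
apply/eqP/cards1P; exists (cell G i (f i)); apply/setP=> v; rewrite !inE.
apply/andP/eqP=> [[/eqP cv /eqP rv]|->]; first by rewrite -rv -cv cellK.
by rewrite row_cell col_cell.
Qed.

Section Admissible.
Variables (X : 'I_d -> {set T}) (M : 'I_g -> {set T}).
Hypothesis XE : forall i, X i = [set v | row G v == i].
Hypothesis ME : forall j, M j = [set v | col G v == j].

Lemma graph_admissible f :
  (0 < d)%N -> monotone f -> admissible X M (graph G f).
Proof.
move=> d_gt0 mono_f.
exists d, (leqnn d), (fun i => cell G i (f i)), f; split=> //.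
- by rewrite card_graph.
- exact: graphE.
- move=> i; rewrite XE ME !inE row_cell col_cell eqxx andbT.
  by apply/eqP/val_inj.
Qed.

(** An admissible set fills only the first rows; the column of its last cell
    is repeated in all the rows after it. *)
Lemma admissible_sub_graph A : admissible X M A ->
  exists2 f, monotone f & A \subset graph G f.
Proof.
case=> [[|k] [le_kd [x [j [[// _ _] -> xXM mono_j]]]]].
exists (fun i : 'I_d => j (inord (minn i k))).
  move=> a b le_ab; apply: mono_j; rewrite !inordK ?ltnS ?geq_minr //.
  by rewrite leq_min geq_minr andbT (leq_trans (geq_minl _ _)).
apply/subsetP=> _ /imsetP[i _ ->]; have := xXM i.
rewrite XE ME !inE => /andP[/eqP-> /eqP->]; apply/eqP; congr j.
by apply: val_inj; rewrite /= (minn_idPl _) ?inordK // -ltnS.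
Qed.

(** Graphs all have d elements, so none lies strictly inside another. *)
Lemma maximal_admissibleP A : (0 < d)%N ->
  maximal_admissible X M A <-> exists2 f, monotone f & A = graph G f.
Proof.
move=> d_gt0; split=> [[admA maxA]|[f mono_f ->]].
  have [f mono_f sAf] := admissible_sub_graph admA.
  by exists f; rewrite // (maxA (graph G f)) //; apply: graph_admissible.
split=> [|B admB sfB]; first exact: graph_admissible.
have [f' mono_f' sBf'] := admissible_sub_graph admB.
apply/esym/eqP; rewrite eqEcard sfB card_graph.
by rewrite -(card_graph f') subset_leq_card.
Qed.

End Admissible.
End MonotoneGraphs.

Lemma monotone_fixpoint n (f : 'I_n -> 'I_n) :
  (0 < n)%N -> monotone f -> exists i, f i = i.
Proof.
case: n f => // n f _ mono_f.
(* The last i with i <= f i: then f i has the same property by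
   monotonicity, so f i <= i. *)
have [i le_if maxi] := @arg_maxnP _ (@ord0 n) (fun i => i <= f i)%N val isT.
by exists i; apply/val_inj/eqP; rewrite /= eqn_leq le_if andbT; apply/maxi/mono_f.
Qed.

(** A fixed point i of h \o f gives the common cell (i, f i). *)
Lemma graphs_meet (T : finType) d g (G : grid T d g) f h :
  (0 < d)%N -> monotone f -> monotone h ->
  exists v, (v \in graph G f) && (v \in graph (transpose G) h).
Proof.
move=> d_gt0 mono_f mono_h.
have [i hfi] : exists i, h (f i) = i.
  by apply: monotone_fixpoint => // a b le_ab; apply/mono_h/mono_f.
by exists (cell G i (f i)); rewrite mem_graph eqxx inE /= row_cell col_cell hfi /=.
Qed.

(** * Blocking every monotone path *)

Section Staircase.
Variables (d g : nat) (A : 'I_d -> 'I_g -> bool).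

(* Cells have natural coordinates here, so that [barrier] can take the value
   [g], which is not a column. *)
Let blocked (a b : nat) : bool :=
  if (insub a, insub b) is (Some i, Some j) then A i j else false.

(** [barrier a.+1] is the column in which the leftmost monotone path avoiding
    [A] crosses row [a]: the first unblocked column at or after the one used in
    the row above.  It is [g] once the path is stuck. *)
Fixpoint barrier a : nat :=
  if a is a'.+1 then
    let s := barrier a' in (s + find (fun b => ~~ blocked a' b) (iota s (g - s)))%N
  else 0.

Lemma barrier_le a : (barrier a <= barrier a.+1)%N.
Proof. exact: leq_addr. Qed.

Lemma barrier_homo a b : (a <= b)%N -> (barrier a <= barrier b)%N.
Proof.
by apply: (@homo_leq _ _ leq) => //; [apply: leq_trans | apply: barrier_le].
Qed.

Lemma barrier_leg a : (barrier a <= g)%N.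
Proof.
elim: a => //= a IH; rewrite -leq_subRL //.
by apply: leq_trans (find_size _ _) _; rewrite size_iota.
Qed.

Lemma below_barrier a b : (barrier a <= b < barrier a.+1)%N -> blocked a b.
Proof.
case/andP=> le_b lt_b; have lt_bg := leq_trans lt_b (barrier_leg a.+1).
move: lt_b; rewrite /= -{1}(subnKC le_b) ltn_add2l => /(before_find 0%N).
by rewrite nth_iota ?ltn_sub2r ?subnKC ?(leq_ltn_trans le_b) // => /negbFE.
Qed.

Lemma at_barrier a : (barrier a.+1 < g)%N -> ~~ blocked a (barrier a.+1).
Proof.
rewrite /=; set s := barrier a; set F := find _ _ => lt_g.
have lt_F : (F < g - s)%N by rewrite ltn_subRL.
have /(nth_find 0%N) : has (fun b => ~~ blocked a b) (iota s (g - s)).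
  by rewrite has_find size_iota.
by rewrite -/F nth_iota.
Qed.

(** The path given by [barrier] meets no blocked cell, so it must get stuck
    before it has crossed all rows.  The columns from [barrier i] up to
    [barrier i.+1] are blocked in row [i], and these intervals cover all the
    columns; [h j] is the row whose interval contains [j]. *)
Lemma monotone_transversal : (0 < d)%N ->
  (forall f : 'I_d -> 'I_g, monotone f -> exists i, A i (f i)) ->
  exists2 h : 'I_g -> 'I_d, monotone h & forall j, A (h j) j.
Proof.
move=> d_gt0 blockA.
have barrier_d : barrier d = g.
  apply/eqP; rewrite eqn_leq barrier_leg leqNgt; apply/negP => lt_dg.
  have lt_g (i : 'I_d) : (barrier i.+1 < g)%N.
    exact: leq_ltn_trans (barrier_homo (ltn_ord i)) lt_dg.
  have [|i] := blockA (fun i => Ordinal (lt_g i)).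
    by move=> a b le_ab; apply: (@barrier_homo a.+1 b.+1).
  have := at_barrier (lt_g i).
  by rewrite /blocked -[barrier i.+1]/(val (Ordinal (lt_g i))) !valK => /negPf->.
have first_row (j : 'I_g) : exists i : 'I_d, (j < barrier i.+1)%N /\
    forall i' : 'I_d, (j < barrier i'.+1)%N -> (i <= i')%N.
  have ltP : (d.-1 < d)%N by rewrite prednK.
  have [|i lti mini] := @arg_minnP _ (Ordinal ltP) (fun i => j < barrier i.+1)%N val.
    by rewrite [X in barrier X](prednK d_gt0) barrier_d.
  by exists i; split=> // i'; apply: mini.
have [h hP] := fin_all_exists first_row.
exists h => [a b le_ab|j].
  by apply: (hP a).2; apply: leq_ltn_trans le_ab (hP b).1.
have [lt_j min_j] := hP j.
have : blocked (h j) j.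
  apply: below_barrier; rewrite lt_j andbT leqNgt; apply/negP.
  case Dh: (val (h j)) => [|i] // lt_ji.
  have lt_id : (i < d)%N by apply: ltn_trans (ltn_ord (h j)); rewrite /= Dh.
  by have := min_j (Ordinal lt_id) lt_ji; rewrite Dh ltnn.
by rewrite /blocked !valK.
Qed.

End Staircase.

(** * Clutters of monotone graphs and their duals *)

Section GridClutter.
Variables (T : finType) (d g : nat) (G : grid T d g) (C : clutter T).
Hypotheses (d_gt0 : (0 < d)%N) (g_gt0 : (0 < g)%N).
Hypothesis edgesC :
  forall A, A \in edges C <-> exists2 f, monotone f & A = graph G f.

Lemma vertex_cover_gridP A :
  vertex_cover C A <-> exists2 h, monotone h & graph (transpose G) h \subset A.
Proof.
split=> [/'forall_implyP coverA|[h mono_h shA]].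
  have [f mono_f|h mono_h Ah] :=
    @monotone_transversal d g (fun i j => cell G i j \in A) d_gt0.
    have /coverA/set0Pn[v] : graph G f \in edges C by apply/edgesC; exists f.
    rewrite inE graphE => /andP[Av /imsetP[i _ Dv]].
    by exists i; rewrite -Dv.
  exists h => //; rewrite graphE; apply/subsetP => _ /imsetP[j _ ->]; exact: Ah.
apply/'forall_implyP => _ /edgesC[f mono_f ->]; apply/set0Pn.
have [v /andP[fv hv]] := graphs_meet G d_gt0 mono_f mono_h.
by exists v; rewrite inE fv (subsetP shA).
Qed.

Lemma vertex_cover_grid_size A : vertex_cover C A -> (g <= #|A|)%N.
Proof.
case/vertex_cover_gridP=> h _ /subset_leq_card.
by rewrite card_graph.
Qed.

(** Each cover contains a graph over the columns; these graphs are themselves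
    minimal, because they have g elements and no cover has fewer. *)
Lemma dual_grid_edges A : A \in edges (alexander_dual C) <->
  exists2 h, monotone h & A = graph (transpose G) h.
Proof.
rewrite inE; split=> [/minsetP[/vertex_cover_gridP[h mono_h shA] minA]|].
  by exists h => //; apply/esym/minA => //; apply/vertex_cover_gridP; exists h.
case=> h mono_h ->; apply/minsetP; split; first by apply/vertex_cover_gridP; exists h.
move=> B coverB sBh; apply/eqP; rewrite eqEcard sBh card_graph.
exact: vertex_cover_grid_size.
Qed.

Lemma grid_complete_admissible_uniform (K : fieldType) :
  complete_admissible_uniform K C.
Proof.
have partX : Defs.indexed_partition (fun i => [set v | row G v == i]).
  by apply: fibers_partition => i; exists (cell G i (Ordinal g_gt0)); rewrite row_cell.
have [injM partM] : Defs.indexed_partition (fun j => [set v | col G v == j]).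
  by apply: fibers_partition => j; exists (cell G (Ordinal d_gt0) j); rewrite col_cell.
exists g, (fun j => [set v | col G v == j]), d, (fun i => [set v | row G v == i]).
split=> //.
- split=> //; have /and3P[/eqP coverM trivM _] := partM; split=> //.
  apply/subsetP=> _ /imsetP[j _ ->]; apply/edgesC.
  by exists (fun=> j).
- apply: edge_ideal_height; last exact: vertex_cover_grid_size.
  exists (graph (transpose G) (fun=> Ordinal d_gt0)); last by rewrite card_graph.
  by apply/vertex_cover_gridP; exists (fun=> Ordinal d_gt0).
- by move=> _ i /edgesC[f _ ->]; apply: card_graph_row.
- by move=> A; apply: (iff_trans (edgesC A)); apply: iff_sym; apply: maximal_admissibleP.
Qed.

End GridClutter.

(** A column of the matching is an edge, so it meets each row in one vertex:
    this gives the cells. *)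
Lemma complete_admissible_uniform_grid (K : fieldType) (T : finType) (C : clutter T) :
  complete_admissible_uniform K C ->
  exists (d g : nat) (G : grid T d g), [/\ (0 < d)%N, (0 < g)%N &
    forall A, A \in edges C <-> exists2 f, monotone f & A = graph G f].
Proof.
case=> [g [M [d [X [[injM [/subsetP sMC trivM coverM]] _ [d_gt0 partX] card_eX edgesC]]]]].
have card_MX j i : #|M j :&: X i| = 1%N by apply/card_eX/sMC/imset_f.
have [row rowE] := partition_fibers partX.
have [|col colE] := @partition_fibers T g M.
  split=> //; rewrite /partition coverM eqxx trivM /=.
  apply/imsetP => -[j _ M0]; have := card_MX j (Ordinal d_gt0).
  by rewrite -M0 set0I cards0.
have cellP (i : 'I_d) : exists c : 'I_g -> T, forall j, M j :&: X i = [set c j].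
  apply: (@fin_all_exists _ _ (fun j v => M j :&: X i = [set v])) => j.
  exact/cards1P/eqP/card_MX.
have [cell cellE] := fin_all_exists cellP.
have rc i j : (col (cell i j) == j) && (row (cell i j) == i).
  by have := set11 (cell i j); rewrite -cellE colE rowE !inE.
have row_cell i j : row (cell i j) = i by case/andP: (rc i j) => _ /eqP.
have col_cell i j : col (cell i j) = j by case/andP: (rc i j) => /eqP.
have cellK v : cell (row v) (col v) = v.
  by apply/esym/set1P; rewrite -cellE colE rowE !inE !eqxx.
pose G := Grid row_cell col_cell cellK.
have [v _] : exists v, v \in X (Ordinal d_gt0).
  case: partX => _ /and3P[_ _ X0]; apply/set0Pn; apply: contra X0 => /eqP <-.
  exact: imset_f.
exists d, g, G; split=> //; first by apply: leq_ltn_trans (ltn_ord (col v)).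
move=> A; apply: (iff_trans (edgesC A)).
exact: (maximal_admissibleP (G := G)).
Qed.

Theorem lemma3p10 (K : fieldType) (T : finType) (C : clutter T) :
  complete_admissible_uniform K C ->
  complete_admissible_uniform K (alexander_dual C).
Proof.
move=> /complete_admissible_uniform_grid[d [g [G [d_gt0 g_gt0 edgesC]]]].
apply: (@grid_complete_admissible_uniform T g d (transpose G)) => //.
exact: dual_grid_edges.
Qed.
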